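(* Let $(\mathbf{X},Y)$, $\mathbf{X}=(X_1,\dots,X_d)$, be a $(d+1)$-dimensional random vector with continuous univariate marginal distribution functions $F_i$ of $X_i$, $i\in\{1,\dots,d\}$, and $G$ of $Y$, and connecting copula $A$. Put $U_i=F_i(X_i)$, $\mathbf{U}=(U_1,\dots,U_d)$ and $V=G(Y)$. Then the following properties hold: (i) $R^2(V,\mathbf{U})=1$ if and only if $Y$ is completely dependent on $\mathbf{X}$; (ii) $R^2(V,\mathbf{U})=0$ if and only if $E(V\mid\mathbf{U}=\mathbf{u})=\frac12$ for $\mu_{A^{1:d}}$-almost all $\mathbf{u}\in[0,1]^d$; in particular, $R^2(V,\mathbf{U})=0$ whenever $Y$ and $\mathbf{X}$ are independent; (iii) $R^2(V,\mathbf{U})$ is invariant with respect to permutations of $X_1,\dots,X_d$; (iv) $R^2(V,\mathbf{U})$ is invariant with respect to continuous and strictly monotone (coordinatewise) transformations of $X_1,\dots,X_d$; (v) $R^2(V,\mathbf{U})$ fulfills the information gain inequality, i.e., for all $k\in\{1,\dots,d\}$, $$R^2(V,U_1)\le R^2(V,(U_1,U_2))\le\dots\le R^2(V,(U_1,\dots,U_k))\le\dots\le R^2(V,(U_1,\dots,U_d));$$ additionally, if, for some $k\in\{1,\dots,d-1\}$, $Y$ and the random vector $(X_{k+1},\dots,X_d)$ are conditionally independent given $(X_1,\dots,X_k)$, then $R^2(V,(U_1,\dots,U_d))=R^2(V,(U_1,\dots,U_k))$.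
   Context: $d\ge 1$ is an integer. For square-integrable $Z$ with positive variance and a random vector $\mathbf{W}$, $R^2(Z,\mathbf{W})=\mathrm{var}(E(Z\mid\mathbf{W}))/\mathrm{var}(Z)$. The connecting copula $A$ of $(\mathbf{X},Y)$ is the distribution function of $(\mathbf{U},V)$; $\mu_{A^{1:d}}$ is the law of $\mathbf{U}$, i.e. the measure of the marginal of $A$ with respect to the first $d$ coordinates. $Y$ is completely dependent on $\mathbf{X}$ if there is a measurable function $f$ with $P(Y=f(\mathbf{X}))=1$. In (iii) and (iv), invariance means that the value of $R^2(V,\mathbf{U})$ is unchanged when $\mathbf{X}$ is replaced by the transformed vector and $\mathbf{U}$ is formed from the marginal distribution functions of that transformed vector. *)

(* Defs.v *)
From HB Require Import structures.
From mathcomp Require Import all_boot all_order all_algebra.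
From mathcomp Require Import all_classical all_reals all_analysis.
From mathcomp Require Import measurable_realfun.

Set Implicit Arguments.
Unset Strict Implicit.
Unset Printing Implicit Defensive.

Import Order.TTheory GRing.Theory Num.Theory.
Import numFieldNormedType.Exports.

Local Open Scope classical_set_scope.
Local Open Scope ring_scope.

Section conditional_expectation.
Context d d' (T : measurableType d) (E : measurableType d') (R : realType).
Variable P : probability T R.
Implicit Types (Z : T -> R) (W : {RV P >-> E}) (g : E -> R).

(* g is a version of u |-> E(Z | W = u). *)
Definition is_condexp_at Z W g : Prop :=
  [/\ measurable_fun [set: E] g,
      (distribution P W).-integrable [set: E] (EFin \o g) &
      forall B, measurable B ->
        (\int[distribution P W]_(u in B) (g u)%:E =
         \int[P]_(w in W @^-1` B) (Z w)%:E)%E].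

(* An arbitrarily chosen version of u |-> E(Z | W = u); versions exist for
   integrable Z by [condexp_atP] below, and any two of them agree almost
   everywhere with respect to the law of W. *)
Definition condexp_at Z W : E -> R := xget (cst 0) [set g | is_condexp_at Z W g].

Definition condexp Z W : T -> R := condexp_at Z W \o W.

Lemma condexp_atP Z W : P.-integrable [set: T] (EFin \o Z) ->
  is_condexp_at Z W (condexp_at Z W).
Proof.
move=> iZ.
have mW : measurable_fun [set: T] W by exact: measurable_funPT.
pose nu : {charge set T -> \bar R} := induced_charge iZ.
pose nuW : {charge set E -> \bar R} :=
  measure_function_pushforward__canonical__charge_Charge nu mW.
have nu_law : nuW `<< distribution P W.
  apply/null_content_dominatesP => B mB PB0.
  apply: null_set_integral => //; last first.
    by apply: (measurable_funS measurableT) => //; exact: measurable_int iZ.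
  exact: measurable_funPTI.
pose h := Radon_Nikodym nuW (distribution P W).
have hfin u : h u \is a fin_num by exact: Radon_Nikodym_fin_num.
have hE : EFin \o (fine \o h) = h by apply/funext => u /=; rewrite fineK.
have ih : (distribution P W).-integrable [set: E] h.
  exact: Radon_Nikodym_integrable.
apply: (@xgetPex _ (cst 0) [set g | is_condexp_at Z W g]).
exists (fine \o h); split; last first.
- move=> B mB; under eq_integral do rewrite /= fineK//.
  by rewrite -Radon_Nikodym_integral.
- by rewrite hE.
- by apply/measurable_EFinP; rewrite hE; exact: measurable_int ih.
Qed.

Definition R2 Z W : R := fine 'V_P[condexp Z W] / fine 'V_P[Z].

Definition independent_RV d2 (E2 : measurableType d2) (Y : {RV P >-> E2}) W :
    Prop :=
  forall (A : set E2) (B : set E), measurable A -> measurable B ->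
    (P (Y @^-1` A `&` W @^-1` B) = P (Y @^-1` A) * P (W @^-1` B))%E.

(* P(Y \in A, Z \in B | W) = P(Y \in A | W) P(Z \in B | W) almost surely, where
   the conditional probability of an event is the conditional expectation of
   its indicator. *)
Definition cond_independent_RV d1 d2 (E1 : measurableType d1)
    (E2 : measurableType d2) (Y : {RV P >-> E1}) (Z : {RV P >-> E2}) W : Prop :=
  forall (A : set E1) (B : set E2), measurable A -> measurable B ->
    {ae P, forall w, condexp (\1_(Y @^-1` A `&` Z @^-1` B)) W w =
      condexp (\1_(Y @^-1` A)) W w * condexp (\1_(Z @^-1` B)) W w}.

Definition completely_dependent (Y : {RV P >-> R}) W : Prop :=
  exists2 f : E -> R, measurable_fun [set: E] f &
    P [set w | Y w = f (W w)] = 1%E.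

End conditional_expectation.

Arguments is_condexp_at {d d' T E R} P Z W g.
Arguments condexp_at {d d' T E R} P Z W u.
Arguments condexp {d d' T E R} P Z W w.
Arguments R2 {d d' T E R} P Z W.
Arguments independent_RV {d d' T E R} P {d2 E2} Y W.
Arguments cond_independent_RV {d d' T E R} P {d1 d2 E1 E2} Y Z W.
Arguments completely_dependent {d d' T E R} P Y W.

Section distribution_function_transform.
Context d (T : measurableType d) (R : realType) (P : probability T R).

Definition dfun (X : {RV P >-> R}) : R -> R := fine \o cdf X.

(* F(X), where F is the distribution function of X *)
Definition dtransform (X : {RV P >-> R}) : T -> R := dfun X \o X.

Lemma measurable_dtransform (X : {RV P >-> R}) :
  measurable_fun [set: T] (dtransform X).
Proof.
apply: measurableT_comp => //; apply: measurableT_comp.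
  exact: fine_measurable.
exact: cdf_measurable.
Qed.

HB.instance Definition _ (X : {RV P >-> R}) :=
  isMeasurableFun.Build _ _ _ _ (dtransform X) (measurable_dtransform X).

End distribution_function_transform.

Arguments dfun {d T R} P X r.
Arguments dtransform {d T R} P X w.

Section random_vector.
Context d (T : measurableType d) (R : realType).

Definition rvec n (X : 'I_n -> {mfun T >-> R}) : T -> n.-tuple R :=
  fun w => [tuple X i w | i < n].

Lemma measurable_rvec n (X : 'I_n -> {mfun T >-> R}) :
  measurable_fun [set: T] (rvec X).
Proof.
apply/measurable_fun_tnthP => i.
rewrite (_ : _ \o _ = X i)//; apply/funext => w /=.
by rewrite tnth_mktuple.
Qed.

HB.instance Definition _ n (X : 'I_n -> {mfun T >-> R}) :=
  isMeasurableFun.Build _ _ _ _ (rvec X) (measurable_rvec X).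

End random_vector.

(* (x_1, ..., x_k) and (x_{k+1}, ..., x_n) *)
Definition initial (A : Type) n k (hk : (k <= n)%N) (x : 'I_n -> A) : 'I_k -> A :=
  fun i => x (widen_ord hk i).

Definition final (A : Type) n k (hk : (k <= n)%N) (x : 'I_n -> A) :
    'I_(n - k) -> A :=
  fun i => x (cast_ord (subnKC hk) (rshift k i)).

Lemma initial_full (A : Type) n (h : (n <= n)%N) (x : 'I_n -> A) :
  initial h x = x.
Proof. by apply/funext => i; congr x; exact: val_inj. Qed.

(* Main.v *)
Require Import Defs.
From mathcomp Require Import all_boot all_order all_algebra all_fingroup.
From mathcomp Require Import all_classical all_reals all_analysis.
From mathcomp Require Import measurable_realfun.
From mathcomp Require Import ring lra.

Set Implicit Arguments.
Unset Strict Implicit.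
Unset Printing Implicit Defensive.

Import Order.TTheory GRing.Theory Num.Theory.
Import numFieldNormedType.Exports.
Import HBNNSimple.

Local Open Scope classical_set_scope.
Local Open Scope ring_scope.

(** Write V = G(Y) and U for the vector of the F_i(X_i).  The proof views the
    conditional expectation as an orthogonal projection and R^2 as the share of
    the variance of V that this projection keeps.

    Since V lies in [0, 1], E(V | W) has a version g(W) with g bounded
    ([bversion_exists]), and the defining identity over the events {W in B}
    extends to E(h(W) g(W)) = E(h(W) V) for every bounded measurable h
    ([mean_test], [bversion_test]).  Everything else about projections is
    Pythagoras.  If W1 is almost surely a measurable function of W2, then
    E(g2(W2) - g1(W1))^2 = E g2(W2)^2 - E g1(W1)^2, hence R^2 grows with the
    information carried by W ([R2_le]) and depends on nothing else ([R2_eq]).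
    Likewise E(V - g(W))^2 = E V^2 - E g(W)^2 characterizes R^2 = 1 ([R2_eq1]),
    and E(g(W) - E V)^2 = E g(W)^2 - (E V)^2 characterizes R^2 = 0 ([R2_eq0]).

    Continuity of the marginals enters through one fact: the intervals on which
    a distribution function F is constant are null, hence the quantile function
    recovers X from F(X) almost surely ([quantile_dtransform]).  So U and X carry
    the same information and R^2(V, U) = R^2(V, X) ([R2_uniformized]), V is not
    almost surely constant, and a relation V = f(X) can be turned into
    Y = f'(X) and back.  The value 1/2 of E V comes from exchanging two
    independent copies of Y ([mean_dtransform]).

    Permutations, strictly monotone transformations (which change F_i(X_i) into
    itself or into 1 - F_i(X_i)) and the passage from (U_1, ..., U_k) to
    (U_1, ..., U_{k+1}) are then instances of [R2_eq] and [R2_le].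

    For the last claim, let W0 and W1 be the first k and the remaining coordinates
    of X, and k_C(W0) = P(W1 in C | W0).  Conditional independence says that
    1_C(W1) and k_C(W0) have the same integrals over all events
    {W0 in A, Y in D}; testing against functions of Y replaces 1_D(Y) by V, and
    self-adjointness of the projection moves it from 1_C(W1) to V
    ([mean_rect]).  A pi-lambda argument passes from rectangles A x C to all
    events of (W0, W1) ([mean_pair]), so that E(V | W0) is also a version of
    E(V | X) ([R2_cond_independent]). *)

(** * Bounded measurable functions and their means *)

Definition bounded_measurable d (T : measurableType d) (R : realType)
    (f : T -> R) : Prop :=
  measurable_fun [set: T] f /\ exists M : R, forall x, `|f x| <= M.

Section bounded_measurable_functions.
Context d (T : measurableType d) (R : realType).
Implicit Types f g : T -> R.

Lemma bmf_cst (c : R) : bounded_measurable (fun _ : T => c).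
Proof. by split; [exact: measurable_cst|exists `|c|]. Qed.

Lemma bmf_indic (A : set T) :
  measurable A -> bounded_measurable (\1_A : T -> R).
Proof.
move=> mA; split; first exact: measurable_indic.
by exists 1 => x; rewrite indicE; case: (x \in A); rewrite ?normr1 ?normr0.
Qed.

Lemma bmfD f g : bounded_measurable f -> bounded_measurable g ->
  bounded_measurable (fun x => f x + g x).
Proof.
move=> [mf [M fM]] [mg [N gN]]; split; first exact: measurable_funD.
by exists (M + N) => x; rewrite (le_trans (ler_normD _ _))// lerD.
Qed.

Lemma bmfB f g : bounded_measurable f -> bounded_measurable g ->
  bounded_measurable (fun x => f x - g x).
Proof.
move=> [mf [M fM]] [mg [N gN]]; split; first exact: measurable_funB.
by exists (M + N) => x; rewrite (le_trans (ler_normB _ _))// lerD.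
Qed.

Lemma bmfM f g : bounded_measurable f -> bounded_measurable g ->
  bounded_measurable (fun x => f x * g x).
Proof.
move=> [mf [M fM]] [mg [N gN]]; split; first exact: measurable_funM.
by exists (M * N) => x; rewrite normrM ler_pM.
Qed.

Lemma bmfX f : bounded_measurable f -> bounded_measurable (fun x => f x ^+ 2).
Proof.
move=> bf; rewrite (_ : (fun _ => _) = fun x => f x * f x); first exact: bmfM.
by apply/funext => x; rewrite expr2.
Qed.

Lemma bmf_sum (I : Type) (s : seq I) (F : I -> T -> R) :
  (forall i, bounded_measurable (F i)) ->
  bounded_measurable (fun x => \sum_(i <- s) F i x).
Proof.
move=> bF; elim: s => [|i s ih].
  rewrite (_ : (fun _ => _) = fun=> 0); first exact: bmf_cst.
  by apply/funext => x; rewrite big_nil.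
rewrite (_ : (fun _ => _) = fun x => F i x + \sum_(j <- s) F j x).
  exact: bmfD.
by apply/funext => x; rewrite big_cons.
Qed.

Lemma bmf_comp d' (E : measurableType d') (W : {mfun T >-> E}) (g : E -> R) :
  bounded_measurable g -> bounded_measurable (fun w => g (W w)).
Proof.
move=> [mg [M gM]]; split; last by exists M => x.
exact: (measurableT_comp mg (measurable_funPT W)).
Qed.

Lemma bmf_itv01 f : measurable_fun [set: T] f -> (forall x, 0 <= f x <= 1) ->
  bounded_measurable f.
Proof.
move=> mf f01; split=> //; exists 1 => x.
by have /andP[f0 f1] := f01 x; rewrite ger0_norm.
Qed.

Lemma bmf_integrable (P : probability T R) f A :
  measurable A -> bounded_measurable f ->
  P.-integrable A (EFin \o f).
Proof.
move=> mA [mf [M fM]]; apply: measurable_bounded_integrable => //.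
- by rewrite (le_lt_trans (probability_le1 _ _))// ltry.
- exact: measurable_funTS.
- exists M; split; first by rewrite num_real.
  by move=> N MN x _ /=; rewrite (le_trans (fM x))// ltW.
Qed.

End bounded_measurable_functions.

#[local] Hint Extern 0 (bounded_measurable _) => solve [assumption] : core.
#[local] Hint Resolve bmf_cst bmf_indic bmfD bmfB bmfM bmfX : core.

Section mean.
Context d (T : measurableType d) (R : realType) (P : probability T R).
Implicit Types f g : T -> R.

Local Notation mean f := (Rintegral P [set: T] f).

Lemma mean_cst (c : R) : mean (fun=> c) = c.
Proof. by rewrite Rintegral_cst//= probability_setT mulr1. Qed.

Lemma meanD f g : bounded_measurable f -> bounded_measurable g ->
  mean (fun w => f w + g w) = mean f + mean g.
Proof. by move=> bf bg; rewrite RintegralD//; exact: bmf_integrable. Qed.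

Lemma meanB f g : bounded_measurable f -> bounded_measurable g ->
  mean (fun w => f w - g w) = mean f - mean g.
Proof. by move=> bf bg; rewrite RintegralB//; exact: bmf_integrable. Qed.

Lemma meanZ c f : bounded_measurable f -> mean (fun w => c * f w) = c * mean f.
Proof. by move=> bf; rewrite RintegralZl//; exact: bmf_integrable. Qed.

Lemma mean_sum (I : Type) (s : seq I) (F : I -> T -> R) :
  (forall i, bounded_measurable (F i)) ->
  mean (fun w => \sum_(i <- s) F i w) = \sum_(i <- s) mean (F i).
Proof.
move=> bF; elim: s => [|i s ih].
  rewrite big_nil -[RHS]mean_cst.
  by apply: eq_Rintegral => w _; rewrite big_nil.
rewrite big_cons -ih -meanD//; last exact: bmf_sum.
by apply: eq_Rintegral => w _; rewrite big_cons.
Qed.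

Lemma mean_ge0 f : (forall w, 0 <= f w) -> 0 <= mean f.
Proof. by move=> f0; apply: Rintegral_ge0 => w _. Qed.

Lemma EFin_mean f : bounded_measurable f ->
  (mean f)%:E = (\int[P]_w (f w)%:E)%E.
Proof.
move=> bf; rewrite /Rintegral fineK//.
by have := integrable_fin_num measurableT (bmf_integrable P measurableT bf).
Qed.

Lemma mean_ae f g : measurable_fun [set: T] f -> measurable_fun [set: T] g ->
  {ae P, forall w, f w = g w} -> mean f = mean g.
Proof.
move=> mf mg fg; congr fine; apply: ae_eq_integral => //.
- exact/measurable_EFinP.
- exact/measurable_EFinP.
- by apply: filterS fg => w /= -> _.
Qed.

Lemma mean_indicM (A : set T) f : mean (fun w => \1_A w * f w) =
  \int[P]_(w in A) f w.
Proof.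
rewrite [RHS]Rintegral_mkcond; apply: eq_Rintegral => w _.
by rewrite patchE indicE; case: (w \in A); rewrite ?mul1r ?mul0r.
Qed.

Lemma mean_sqr_eq0 f : bounded_measurable f ->
  mean (fun w => f w ^+ 2) = 0 <-> {ae P, forall w, f w = 0}.
Proof.
move=> bf; split => [m0|f0]; last first.
  rewrite -(mean_cst 0); apply: mean_ae => //; first by case: (bmfX bf).
  by apply: filterS f0 => w /= ->; rewrite expr0n.
have : ae_eq P [set: T] (fun w => (f w ^+ 2)%:E) (cst 0%E).
  apply/(ae_eq_integral_abs P measurableT) => //.
    by apply/measurable_EFinP; case: (bmfX bf).
  under eq_integral do rewrite /= ger0_norm ?sqr_ge0//.
  by rewrite -EFin_mean ?m0//; exact: bmfX.
apply: filterS => w /= /(_ I) [] /eqP; rewrite sqrf_eq0 => /eqP //.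
Qed.

End mean.

(** * Almost sure statements and laws *)

Section almost_everywhere_laws.
Context d (T : measurableType d) (R : realType) (P : probability T R).

Lemma measurable_eq_set d' (E : measurableType d') (f g : E -> R) :
  measurable_fun [set: E] f -> measurable_fun [set: E] g ->
  measurable [set x | f x = g x].
Proof.
move=> mf mg.
rewrite (_ : [set _ | _] = (fun x => f x == g x) @^-1` [set true]).
  by rewrite -[X in measurable X]setTI; exact: measurable_fun_eqr.
by apply/seteqP; split => x /= /eqP.
Qed.

Lemma ae_probability1 (A : set T) : measurable A ->
  P A = 1%E <-> {ae P, forall w, A w}.
Proof.
move=> mA; have PC := probability_setC P mA; split => [PA|].
  by exists (~` A); split => //; [exact: measurableC|rewrite PC PA subee].
move=> /(negligibleP P (measurableC mA)) PC0.
by rewrite -(setCK A) probability_setC ?PC0 ?sube0//; exact: measurableC.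
Qed.

Context d' (E : measurableType d') (W : {RV P >-> E}).

Lemma ae_preimage (Q : set E) : {ae distribution P W, forall x, Q x} ->
  {ae P, forall w, Q (W w)}.
Proof.
move=> [N [mN N0 QN]]; exists (W @^-1` N); split => //.
  exact: measurable_funPTI.
by move=> w /= nQ; exact: QN.
Qed.

Lemma ae_distribution (Q : set E) : measurable Q ->
  {ae P, forall w, Q (W w)} -> {ae distribution P W, forall x, Q x}.
Proof.
move=> mQ [N [mN N0 QN]]; exists (~` Q); split => //; first exact: measurableC.
have mW : measurable (W @^-1` (~` Q)).
  by apply: measurable_funPTI; exact: measurableC.
exact: subset_measure0 mN QN N0.
Qed.

End almost_everywhere_laws.

(** * Testing integrals against functions of a random variable *)

Section testing.
Context d d' (T : measurableType d) (E : measurableType d') (R : realType).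
Variables (P : probability T R) (W : {RV P >-> E}).
Implicit Types (D H K : T -> R) (h : E -> R).

Local Notation mean f := (Rintegral P [set: T] f).

(** The hypothesis is the claim for indicators h.  Linearity gives it for simple
    h, dominated convergence for nonnegative h, and adding a constant to h
    removes the sign condition. *)
Lemma mean_test_eq0 D h : bounded_measurable D -> bounded_measurable h ->
  (forall B, measurable B -> mean (fun w => \1_(W @^-1` B) w * D w) = 0) ->
  mean (fun w => h (W w) * D w) = 0.
Proof.
move=> bD bh D0.
have simple (s : {nnsfun E >-> R}) : mean (fun w => s (W w) * D w) = 0.
  have b y : bounded_measurable
      (fun w => y * (\1_(W @^-1` (s @^-1` [set y])) w * D w)).
    apply: bmfM => //; apply: bmfM => //; apply: bmf_indic.
    exact: measurable_funPTI.
  transitivity (mean (fun w => \sum_(y <- finmap.enum_fset (fset_set (range s)))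
      y * (\1_(W @^-1` (s @^-1` [set y])) w * D w))).
    apply: eq_Rintegral => w _; rewrite [in LHS](fimfunE s) fsbig_finite//=.
    by rewrite mulr_suml; apply: eq_bigr => y _; rewrite mulrA.
  rewrite mean_sum//; apply: big1 => y _; rewrite meanZ ?D0 ?mulr0//.
  by apply: bmfM => //; apply: bmf_indic; exact: measurable_funPTI.
have nonneg (f : E -> R) : bounded_measurable f -> (forall x, 0 <= f x) ->
    mean (fun w => f (W w) * D w) = 0.
  move=> bf f0; have [mf [M fM]] := bf; have [mD [N DN]] := bD.
  have mfE : measurable_fun [set: E] (EFin \o f) by exact/measurable_EFinP.
  pose s := nnsfun_approx measurableT mfE.
  have sf x : EFin \o (s ^~ x) @ \oo --> (f x)%:E.
    apply: (@cvg_nnsfun_approx _ _ _ _ measurableT _ mfE) => // y _.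
    by rewrite lee_fin.
  have s_le n x : s n x <= f x.
    have sfx : s ^~ x @ \oo --> f x by have /fine_cvgP[_] := sf x.
    rewrite -(cvg_lim _ sfx)//; apply: nondecreasing_cvgn_le.
      by move=> p q pq; exact/lefP/nd_nnsfun_approx.
    by apply/cvg_ex; exists (f x).
  have s_bnd n x : `|s n x| <= M.
    by rewrite ger0_norm// (le_trans (s_le n x))// (le_trans (ler_norm _)).
  have bs n : bounded_measurable (s n) by split=> //; exists M.
  have : (\int[P]_w (s n (W w) * D w)%:E)%E @[n --> \oo] -->
      (\int[P]_w (f (W w) * D w)%:E)%E.
    apply: (@dominated_cvg _ _ _ _ _ measurableT _ _ (fun=> (M * N)%:E)) => //.
    - by move=> n; apply/measurable_EFinP; case: (bmfM (bmf_comp W (bs n)) bD).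
    - move=> w _; under eq_fun do rewrite EFinM; rewrite EFinM.
      by apply: cvgeZr => //; exact: (sf (W w)).
    - exact: finite_measure_integrable_cst.
    - by move=> n w _; rewrite lee_fin normrM ler_pM.
  have s0 n : (\int[P]_w (s n (W w) * D w)%:E)%E = 0%E.
    by rewrite -EFin_mean ?simple//; apply: bmfM => //; exact: bmf_comp (bs n).
  under eq_fun do rewrite s0.
  move=> /(cvg_lim (@ereal_hausdorff R)); rewrite lim_cst//.
  rewrite -EFin_mean; last by apply: bmfM => //; exact: bmf_comp bf.
  by case.
(* h + N is nonnegative and constants integrate D to 0. *)
have [mh [M hM]] := bh; pose N := `|M|.
have Nh x : 0 <= h x + N.
  rewrite -lerBlDr sub0r lerNl (le_trans _ (ler_norm M))//.
  by rewrite (le_trans _ (hM x))// -normrN ler_norm.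
have bN : bounded_measurable (fun x => h x + N) by exact: bmfD.
have := nonneg _ bN Nh; under eq_Rintegral do rewrite mulrDl.
have N0 := nonneg _ (bmf_cst E N) (fun=> normr_ge0 M).
by rewrite meanD ?N0 ?addr0//; apply: bmfM => //; exact: bmf_comp bh.
Qed.

(** Two integrands with the same integrals over the events determined by W cannot
    be distinguished by functions of W.  This single principle yields the pull-out
    property of conditional expectations as well as the passage from events to
    functions of Y under (conditional) independence. *)
Lemma mean_test H K h :
  bounded_measurable H -> bounded_measurable K -> bounded_measurable h ->
  (forall B, measurable B ->
    mean (fun w => \1_(W @^-1` B) w * H w) =
    mean (fun w => \1_(W @^-1` B) w * K w)) ->
  mean (fun w => h (W w) * H w) = mean (fun w => h (W w) * K w).
Proof.
move=> bH bK bh HK; apply/eqP; rewrite -subr_eq0 -meanB; last 2 first.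
- by apply: bmfM => //; exact: bmf_comp bh.
- by apply: bmfM => //; exact: bmf_comp bh.
apply/eqP; under eq_Rintegral do rewrite -mulrBr.
apply: (@mean_test_eq0 (fun w => H w - K w)) => // [|B mB]; first exact: bmfB.
have mWB : d.-measurable (W @^-1` B) by exact: measurable_funPTI.
under eq_Rintegral do rewrite mulrBr.
by rewrite meanB ?HK ?subrr//; apply: bmfM => //; exact: bmf_indic.
Qed.

End testing.

(** * Variance of bounded functions *)

Section variance_bounded.
Context d (T : measurableType d) (R : realType) (P : probability T R).
Implicit Types f g : T -> R.

Local Notation mean f := (Rintegral P [set: T] f).

Lemma fine_variance_ae f g : measurable_fun [set: T] f ->
  measurable_fun [set: T] g -> {ae P, forall w, f w = g w} ->
  fine 'V_P[f] = fine 'V_P[g].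
Proof.
move=> mf mg fg; rewrite /variance !covariance.unlock.
have -> : fine 'E_P[f] = fine 'E_P[g].
  by rewrite expectation.unlock; exact: (mean_ae mf mg fg).
rewrite expectation.unlock; set b := fine (\int[P]_w (g w)%:E)%E.
have m (h : T -> R) : measurable_fun [set: T] h ->
    measurable_fun [set: T] (fun w => (h w - b) * (h w - b)).
  by move=> mh; apply: measurable_funM; exact: measurable_funB.
apply: (mean_ae (m _ mf) (m _ mg)).
by apply: filterS fg => w /= ->.
Qed.

Lemma fine_varianceE f : bounded_measurable f ->
  fine 'V_P[f] = mean (fun w => (f w - mean f) ^+ 2).
Proof.
move=> bf; rewrite /variance !covariance.unlock expectation.unlock /=.
by congr fine; apply: eq_integral => w _; rewrite expr2.
Qed.

Lemma mean_sqrB f g : bounded_measurable f -> bounded_measurable g ->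
  mean (fun w => (f w - g w) ^+ 2) =
  mean (fun w => f w ^+ 2) - 2 * mean (fun w => f w * g w) +
  mean (fun w => g w ^+ 2).
Proof.
move=> bf bg; rewrite -meanZ; last exact: bmfM.
rewrite -meanB; [|exact: bmfX|by apply: bmfM => //; exact: bmfM].
rewrite -meanD; last 2 first.
- by apply: bmfB; [exact: bmfX|apply: bmfM => //; exact: bmfM].
- exact: bmfX.
by apply: eq_Rintegral => w _; ring.
Qed.

Lemma fine_variance_sqr f : bounded_measurable f ->
  fine 'V_P[f] = mean (fun w => f w ^+ 2) - mean f ^+ 2.
Proof.
move=> bf; rewrite fine_varianceE// mean_sqrB// mean_cst.
under [X in _ - 2 * X]eq_Rintegral do rewrite mulrC.
by rewrite meanZ//; ring.
Qed.

End variance_bounded.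

(** * Bounded versions of the conditional expectation *)

(** Over the set B where f < 0, the integral of |f| is minus that of f, which is
    nonnegative; hence it vanishes. *)
Lemma integral_ge0_ae d (T : measurableType d) (R : realType)
    (mu : {measure set T -> \bar R}) (f : T -> R) :
  mu.-integrable [set: T] (EFin \o f) ->
  (forall B, measurable B -> (0 <= \int[mu]_(x in B) (f x)%:E)%E) ->
  {ae mu, forall x, 0 <= f x}.
Proof.
move=> fi f0; have mf : measurable_fun [set: T] f.
  by apply/measurable_EFinP; exact: measurable_int fi.
pose B := [set x | f x < 0].
have mB : measurable B.
  rewrite (_ : B = f @^-1` `]-oo, 0[%classic); last first.
    by apply/seteqP; split => x; rewrite /B /= in_itv.
  by rewrite -[X in measurable X]setTI; exact: mf.
have : (\int[mu]_(x in B) `|(EFin \o f) x|)%E = 0%E.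
  apply/eqP; rewrite eq_le integral_ge0// andbT.
  under eq_integral => x /set_mem xB.
    rewrite /= ltr0_norm// EFinN; over.
  rewrite integralN; first by rewrite leeNl oppe0 f0.
  by apply: integrable_add_def => //; exact: integrableS measurableT mB _ fi.
move/(ae_eq_integral_abs mu mB (measurable_funTS (measurable_int _ fi))).
apply: filterS => x /= xB; rewrite leNgt; apply/negP => fx0.
by have [] := xB fx0 => fx; rewrite fx ltxx in fx0.
Qed.

Section versions.
Context d d' (T : measurableType d) (E : measurableType d') (R : realType).
Variables (P : probability T R) (W : {RV P >-> E}).
Implicit Types (Z : T -> R) (g : E -> R).

Local Notation mean f := (Rintegral P [set: T] f).

(** g(W) is a conditional expectation of Z given W; boundedness keeps all the
    products below integrable, and integrals over T instead of the law of W make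
    versions for different W comparable. *)
Definition bounded_version Z g : Prop := bounded_measurable g /\
  forall B, measurable B -> mean (fun w => \1_(W @^-1` B) w * g (W w)) =
                            mean (fun w => \1_(W @^-1` B) w * Z w).

(** The pull-out property: g(W) is the orthogonal projection of Z onto the
    bounded functions of W. *)
Lemma bversion_test Z g h :
  bounded_measurable Z -> bounded_version Z g -> bounded_measurable h ->
  mean (fun w => h (W w) * g (W w)) = mean (fun w => h (W w) * Z w).
Proof.
by move=> bZ [bg Hg] bh; apply: mean_test => //; exact: bmf_comp bg.
Qed.

Lemma mean_bversion Z g : bounded_measurable Z -> bounded_version Z g ->
  mean (fun w => g (W w)) = mean Z.
Proof.
move=> bZ vg; have := bversion_test bZ vg (bmf_cst E 1).
under eq_Rintegral do rewrite mul1r.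
by under [RHS]eq_Rintegral do rewrite mul1r.
Qed.

(** Testing both versions against their difference shows that the difference has
    mean square zero. *)
Lemma bversion_unique Z g1 g2 :
  bounded_measurable Z -> bounded_version Z g1 -> bounded_version Z g2 ->
  {ae P, forall w, g1 (W w) = g2 (W w)}.
Proof.
move=> bZ v1 v2; have [[b1 _] [b2 _]] := (v1, v2).
have b12 : bounded_measurable (fun x => g1 x - g2 x) by exact: bmfB.
have [c1 c2] := (bmf_comp W b1, bmf_comp W b2).
suff /mean_sqr_eq0 : mean (fun w => (g1 (W w) - g2 (W w)) ^+ 2) = 0.
  move=> /(_ (bmfB c1 c2)); apply: filterS => w /= /eqP.
  by rewrite subr_eq0 => /eqP.
under eq_Rintegral do rewrite expr2 mulrBr.
rewrite meanB; [|by apply: bmfM => //; exact: bmfB..].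
by rewrite (bversion_test bZ v1 b12) (bversion_test bZ v2 b12) subrr.
Qed.

End versions.

Arguments bounded_version {d d' T E R} P W Z g.

Section existence_of_versions.
Context d d' (T : measurableType d) (E : measurableType d') (R : realType).
Variables (P : probability T R) (W : {RV P >-> E}) (Z : T -> R).
Hypothesis mZ : measurable_fun [set: T] Z.
Hypothesis Z01 : forall w, 0 <= Z w <= 1.

Local Notation mean f := (Rintegral P [set: T] f).

Let bZ : bounded_measurable Z. Proof. exact: bmf_itv01. Qed.

(** Z and 1 - Z have nonnegative integrals over the events {W in B}, hence so
    have E(Z | W = x) and 1 - E(Z | W = x) over the sets B. *)
Lemma condexp_at_itv01 :
  {ae distribution P W, forall x, 0 <= condexp_at P Z W x <= 1}.
Proof.
have iZ := bmf_integrable P measurableT bZ.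
have [mc ic c_int] := condexp_atP W iZ.
set c := condexp_at P Z W in mc ic c_int *.
have c0 : {ae distribution P W, forall x, 0 <= c x}.
  apply: integral_ge0_ae => // B mB; rewrite c_int// integral_ge0// => w _.
  by rewrite lee_fin; case/andP: (Z01 w).
have c1 : {ae distribution P W, forall x, 0 <= 1 - c x}.
  apply: integral_ge0_ae => [|B mB].
    exact: (integrableB measurableT
      (finite_measure_integrable_cst _ 1 measurableT) ic).
  have mWB : measurable (W @^-1` B) by exact: measurable_funPTI.
  have -> : (\int[distribution P W]_(x in B) (1 - c x)%:E =
      \int[P]_(w in W @^-1` B) (1 - Z w)%:E)%E.
    under eq_integral do rewrite EFinB.
    rewrite integralB//; last 2 first.
    - exact: finite_measure_integrable_cst.
    - exact: integrableS measurableT _ _ ic.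
    rewrite c_int// integral_cst//.
    under [in RHS]eq_integral do rewrite EFinB.
    rewrite integralB//; last 2 first.
    - exact: finite_measure_integrable_cst.
    - exact: integrableS measurableT _ _ iZ.
    by rewrite integral_cst.
  rewrite integral_ge0// => w _.
  by rewrite lee_fin subr_ge0; case/andP: (Z01 w).
by apply: filterS2 c0 c1 => x -> /=; rewrite subr_ge0.
Qed.

(** The arbitrarily chosen version of the conditional expectation may be
    unbounded on a null set; truncating it to [0, 1] cures this. *)
Lemma bversion_exists : exists g : E -> R, bounded_version P W Z g /\
  {ae distribution P W, forall x, condexp_at P Z W x = g x}.
Proof.
have iZ := bmf_integrable P measurableT bZ.
have [mc ic c_int] := condexp_atP W iZ.
have := condexp_at_itv01.
set c := condexp_at P Z W in mc ic c_int * => c01.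
pose g x := Num.max 0 (Num.min 1 (c x)).
have mg : measurable_fun [set: E] g.
  by apply: measurable_maxr => //; exact: measurable_minr.
have g01 x : 0 <= g x <= 1.
  by rewrite /g le_max lexx ge_max ler01 ge_min lexx.
have bg : bounded_measurable g by exact: bmf_itv01.
have cg : {ae distribution P W, forall x, c x = g x}.
  apply: filterS c01 => x /= /andP[c0 c1].
  by rewrite /g (min_idPr c1) (max_idPr c0).
exists g; split => //; split => // B mB.
have mWB : measurable (W @^-1` B) by exact: measurable_funPTI.
rewrite !mean_indicM /Rintegral -c_int//; congr fine.
transitivity (\int[distribution P W]_(x in B) (g x)%:E)%E.
  rewrite integral_pushforward//.
  - exact/measurable_EFinP.
  - exact: (bmf_integrable P mWB (bmf_comp W bg)).
apply: ae_eq_integral => //.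
- by apply/measurable_EFinP; exact: measurable_funTS.
- by apply/measurable_EFinP; exact: measurable_funTS.
- by apply: filterS cg => x /= ->.
Qed.

Lemma condexp_bversion g : bounded_version P W Z g ->
  {ae P, forall w, condexp P Z W w = g (W w)}.
Proof.
move=> vg; have [g' [vg' cg']] := bversion_exists.
have /ae_preimage := cg'.
by apply: filterS2 (bversion_unique bZ vg' vg) => w /= <- <-.
Qed.

(** R^2 is computed from any bounded version; the projection keeps the mean, so
    only its second moment matters. *)
Lemma R2_bversion g : bounded_version P W Z g ->
  R2 P Z W = (mean (fun w => g (W w) ^+ 2) - mean Z ^+ 2) / fine 'V_P[Z].
Proof.
move=> vg; have [bg _] := vg; have bgW := bmf_comp W bg.
rewrite /R2 (fine_variance_ae _ _ (condexp_bversion vg)); last 2 first.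
- have [mc _ _] := condexp_atP W (bmf_integrable P measurableT bZ).
  exact: (measurableT_comp mc (measurable_funPT W)).
- by case: bgW.
by rewrite fine_variance_sqr// (mean_bversion bZ vg).
Qed.

End existence_of_versions.

(** * Coefficient of determination and information *)

Section gain.
Context d (T : measurableType d) (R : realType).
Variables (P : probability T R) (Z : T -> R).
Hypothesis mZ : measurable_fun [set: T] Z.
Hypothesis Z01 : forall w, 0 <= Z w <= 1.
Let bZ : bounded_measurable Z. Proof. exact: bmf_itv01. Qed.

Local Notation mean f := (Rintegral P [set: T] f).

(** Projecting onto the functions of W2 and then onto the smaller space of
    functions of W1 is projecting onto the latter: E(g2 g1) = E(g1^2), and the
    gain in R^2 is proportional to E(g2 - g1)^2. *)
Lemma R2_le d1 d2 (E1 : measurableType d1) (E2 : measurableType d2)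
    (W1 : {RV P >-> E1}) (W2 : {RV P >-> E2}) (phi : E2 -> E1) :
  measurable_fun [set: E2] phi -> {ae P, forall w, W1 w = phi (W2 w)} ->
  R2 P Z W1 <= R2 P Z W2.
Proof.
move=> mphi W12.
have [g1 [v1 _]] := bversion_exists W1 mZ Z01.
have [g2 [v2 _]] := bversion_exists W2 mZ Z01.
have [[b1 _] [b2 _]] := (v1, v2).
have [c1 c2] := (bmf_comp W1 b1, bmf_comp W2 b2).
rewrite (R2_bversion mZ Z01 v1) (R2_bversion mZ Z01 v2).
rewrite ler_wpM2r ?invr_ge0 ?fine_ge0 ?variance_ge0// lerB//.
have b1phi : bounded_measurable (fun x => g1 (phi x)).
  have [mg1 [M g1M]] := b1; split; last by exists M => x.
  exact: measurableT_comp.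
have cross : mean (fun w => g2 (W2 w) * g1 (W1 w)) =
    mean (fun w => g1 (W1 w) ^+ 2).
  under [RHS]eq_Rintegral do rewrite expr2.
  rewrite (bversion_test bZ v1 b1).
  have c1phi := bmf_comp W2 b1phi.
  transitivity (mean (fun w => g1 (phi (W2 w)) * Z w)).
    rewrite -(bversion_test bZ v2 b1phi).
    apply: mean_ae; [by case: (bmfM c2 c1)|by case: (bmfM c1phi c2)|].
    by apply: filterS W12 => w /= ->; rewrite mulrC.
  apply: mean_ae; [by case: (bmfM c1phi bZ)|by case: (bmfM c1 bZ)|].
  by apply: filterS W12 => w /= ->.
have := mean_ge0 P (fun w => sqr_ge0 (g2 (W2 w) - g1 (W1 w))).
rewrite mean_sqrB// cross; lra.
Qed.

Lemma R2_eq d1 d2 (E1 : measurableType d1) (E2 : measurableType d2)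
    (W1 : {RV P >-> E1}) (W2 : {RV P >-> E2})
    (phi : E2 -> E1) (psi : E1 -> E2) :
  measurable_fun [set: E2] phi -> {ae P, forall w, W1 w = phi (W2 w)} ->
  measurable_fun [set: E1] psi -> {ae P, forall w, W2 w = psi (W1 w)} ->
  R2 P Z W1 = R2 P Z W2.
Proof.
move=> mphi W12 mpsi W21; apply/eqP.
by rewrite eq_le !(R2_le _ W12, R2_le _ W21).
Qed.

Context d1 (E : measurableType d1) (W : {RV P >-> E}).

(** Equality case of E(g(W) - E Z)^2 = E g(W)^2 - (E Z)^2. *)
Lemma R2_eq0 : fine 'V_P[Z] != 0 ->
  R2 P Z W = 0 <-> {ae P, forall w, condexp P Z W w = mean Z}.
Proof.
move=> V0; have [g [vg _]] := bversion_exists W mZ Z01.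
have [bg _] := vg; have bgW := bmf_comp W bg.
have cg := condexp_bversion mZ Z01 vg.
have E0 : mean (fun w => (g (W w) - mean Z) ^+ 2) =
    mean (fun w => g (W w) ^+ 2) - mean Z ^+ 2.
  rewrite mean_sqrB// mean_cst.
  under [X in _ - 2 * X]eq_Rintegral do rewrite mulrC.
  by rewrite meanZ// (mean_bversion bZ vg); ring.
have Q : R2 P Z W = 0 <-> {ae P, forall w, g (W w) - mean Z = 0}.
  rewrite -mean_sqr_eq0; last exact: bmfB.
  rewrite E0 (R2_bversion mZ Z01 vg); split => [/eqP|->]; last by rewrite mul0r.
  by rewrite mulf_eq0 invr_eq0 (negbTE V0) orbF => /eqP.
rewrite Q; split; apply: filterS2 cg => w /= -> /eqP.
  by rewrite subr_eq0 => /eqP.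
by rewrite -subr_eq0 => /eqP.
Qed.

(** Equality case of E(Z - g(W))^2 = E Z^2 - E g(W)^2: a variable coincides with
    its projection exactly when it lies in the space of functions of W. *)
Lemma R2_eq1 : fine 'V_P[Z] != 0 ->
  R2 P Z W = 1 <-> exists2 f : E -> R, measurable_fun [set: E] f &
    {ae P, forall w, Z w = f (W w)}.
Proof.
move=> V0; have [g [vg _]] := bversion_exists W mZ Z01.
have [bg _] := vg; have bgW := bmf_comp W bg.
have E1 : mean (fun w => (Z w - g (W w)) ^+ 2) =
    mean (fun w => Z w ^+ 2) - mean (fun w => g (W w) ^+ 2).
  rewrite mean_sqrB//; under [X in _ - 2 * X]eq_Rintegral do rewrite mulrC.
  rewrite -(bversion_test bZ vg bg).
  by under [X in _ - 2 * X]eq_Rintegral do rewrite -expr2; ring.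
have Q : R2 P Z W = 1 <-> {ae P, forall w, Z w - g (W w) = 0}.
  rewrite -mean_sqr_eq0; last exact: bmfB.
  rewrite E1 (R2_bversion mZ Z01 vg).
  have -> x : x / fine 'V_P[Z] = 1 <-> x = fine 'V_P[Z].
    by split=> [xV|->]; [rewrite -[LHS](divfK V0) xV mul1r|rewrite divff].
  by rewrite (fine_variance_sqr P bZ); split; lra.
rewrite Q; split => [Zg|[f mf Zf]].
  exists g; first by case: bg.
  by apply: filterS Zg => w /= /eqP; rewrite subr_eq0 => /eqP.
(* f is only measurable; as Z lies in [0, 1], truncating f leaves Z = f(W)
   intact and makes f a legitimate test function. *)
pose f1 x := Num.max 0 (Num.min 1 (f x)).
have mf1 : measurable_fun [set: E] f1.
  by apply: measurable_maxr => //; exact: measurable_minr.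
have bf1 : bounded_measurable f1.
  apply: bmf_itv01 => // x.
  by rewrite /f1 le_max lexx ge_max ler01 ge_min lexx.
have Zf1 : {ae P, forall w, Z w = f1 (W w)}.
  apply: filterS Zf => w /= Zfw; have /andP[Z0 Z1] := Z01 w.
  by rewrite /f1 -Zfw (min_idPr Z1) (max_idPr Z0).
apply/mean_sqr_eq0; first exact: bmfB.
have b : bounded_measurable (fun x => f1 x - g x) by exact: bmfB.
have bW := bmf_comp W b.
transitivity (mean (fun w => (f1 (W w) - g (W w)) * (Z w - g (W w)))).
  apply: mean_ae.
  - by case: (bmfX (bmfB bZ bgW)).
  - by case: (bmfM bW (bmfB bZ bgW)).
  - by apply: filterS Zf1 => w /= <-; rewrite expr2.
under eq_Rintegral do rewrite mulrBr.
rewrite meanB; [|exact: bmfM..].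
by rewrite (bversion_test bZ vg b) subrr.
Qed.

End gain.

(** * Continuous distribution functions and quantiles *)

Section continuous_marginal.
Context d (T : measurableType d) (R : realType) (P : probability T R).
Variable X : {RV P >-> R}.

Lemma dfunE x : (dfun P X x)%:E = P [set w | X w <= x].
Proof.
by rewrite /dfun /= /cdf fineK ?fin_num_measure.
Qed.

Lemma dfun_nondecreasing : {homo dfun P X : x y / x <= y}.
Proof.
move=> x y xy; rewrite /dfun /= fine_le ?fin_num_measure//.
exact: cdf_nondecreasing.
Qed.

Lemma dfun_itv01 x : 0 <= dfun P X x <= 1.
Proof.
rewrite -!lee_fin dfunE; apply/andP; split => //; apply: probability_le1.
rewrite (_ : [set _ | _] = X @^-1` `]-oo, x]%classic); last first.
  by apply/seteqP; split => w; rewrite /= in_itv.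
exact: measurable_funPTI.
Qed.

Lemma distribution_itv_oc x y : x <= y ->
  distribution P X `]x, y] = (dfun P X y - dfun P X x)%:E.
Proof.
move=> xy; have : (distribution P X `]-oo, y] =
    distribution P X `]-oo, x] + distribution P X `]x, y])%E.
  rewrite -measureU//; last first.
    by apply/seteqP; split => z //= []; rewrite !in_itv/=; lra.
  by rewrite -itv_bndbnd_setU.
rewrite EFinB /dfun /= /cdf EFinN !fineK ?fin_num_measure// => ->.
by rewrite [X in (X - _)%E]addeC addeK ?fin_num_measure.

Qed.

Lemma measurable_dfun : measurable_fun [set: R] (dfun P X).
Proof. exact: nondecreasing_measurable dfun_nondecreasing. Qed.

Hypothesis cF : continuous (dfun P X).

Lemma distribution_set1 x : distribution P X [set x] = 0%E.
Proof.
apply/eqP; rewrite eq_le measure_ge0 andbT.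
rewrite -(@fineK _ (distribution P X [set x])) ?fin_num_measure// lee_fin.
apply/ler_addgt0Pr => e e0; rewrite add0r.
have /cvgrPdist_lt/(_ e e0)/nbhs_ballP[r /= r0 xr] :
  dfun P X y @[y --> x] --> dfun P X x by exact: cF.
have yx : x - r / 2 <= x by rewrite lerBlDr lerDl; lra.
have /xr/= : ball x r (x - r / 2).
  by rewrite /ball /= opprB addrC subrK gtr0_norm; lra.
rewrite ger0_norm ?subr_ge0 ?dfun_nondecreasing// => /ltW; apply: le_trans.
rewrite -lee_fin -distribution_itv_oc// fineK ?fin_num_measure//.
by apply: le_measure; rewrite ?inE// => z ->/=; rewrite in_itv/=; lra.
Qed.

Lemma measurable_level c : measurable [set x | dfun P X x = c].
Proof.
rewrite (_ : [set _ | _] = dfun P X @^-1` [set c])//.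
by rewrite -[X in measurable X]setTI; exact: continuous_measurable_fun cF _ _ _.
Qed.

Lemma closed_level c : closed [set x | dfun P X x = c].
Proof.
rewrite (_ : [set _ | _] = dfun P X @^-1` [set y | y = c])//.
by apply: preimage_closed => [x _|]; [exact: cF|exact: closed_eq].
Qed.

(** If F stays at the value F(r) to the right of r, it does so up to the supremum
    s of that level set, where F(s) = F(r) by continuity; the interval ]r, s] has
    mass F(s) - F(r) = 0.  Cutting at n makes the supremum finite. *)
Lemma flat_null r : distribution P X
  [set x | r < x /\ dfun P X x = dfun P X r] = 0%E.
Proof.
set F := dfun P X.
pose A n := [set x | r < x <= n%:R /\ F x = F r].
have mA n : measurable (A n).
  rewrite (_ : A n = `]r, n%:R]%classic `&` [set x | F x = F r]).
    by apply: measurableI => //; exact: measurable_level.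
  by apply/seteqP; split => x; rewrite /A /= in_itv.
have -> : [set x | r < x /\ F x = F r] = \bigcup_n A n.
  apply/seteqP; split => [x [rx Fx]|x [n _ [/andP[rx _] Fx]]]; last by [].
  exists (Num.truncn x).+1 => //; split => //.
  by rewrite rx ltW// truncnS_gt.
apply/negligibleP; first exact: bigcup_measurable.
apply: negligible_bigcup => n; apply/negligibleP => //.
have [->|/set0P A0] := eqVneq (A n) set0; first by rewrite measure0.
have ubA : has_ubound (A n) by exists n%:R => x [/andP[]].
have rs : r <= sup (A n).
  have [x Ax] := A0; have [/andP[rx _] _] := Ax.
  by rewrite (le_trans (ltW rx))//; exact: ub_le_sup.
have Fs : F (sup (A n)) = F r.
  apply: (closed_level (c := F r)).
  by apply: closureS (closure_sup A0 ubA) => x [].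
apply/eqP; rewrite eq_le measure_ge0 andbT.
rewrite (_ : 0%E = distribution P X `]r, sup (A n)]); last first.
  by rewrite distribution_itv_oc// -/F Fs subrr.
apply: le_measure; rewrite ?inE// => x Ax; rewrite /= in_itv/=.
by case: (Ax) => /andP[-> _] _ /=; exact: ub_le_sup.
Qed.

(** The left-continuous quantile function.  Values in the extended reals make it
    monotone on the whole line, hence measurable. *)
Definition equantile (u : R) : \bar R :=
  ereal_sup [set x%:E | x in [set x | dfun P X x < u]].

Lemma measurable_equantile : measurable_fun [set: R] equantile.
Proof.
move=> mD; apply: (measurability _ (ErealGenCInfty.measurableE R)) => //.
move=> _ [_ [r ->] <-]; rewrite setTI; apply: is_interval_measurable.
move=> s t /=; rewrite !in_itv /= !andbT => rs _ u /andP[su _].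
rewrite in_itv /= andbT (le_trans rs)//; apply: ereal_sup_le.
by apply: image_subset => x /= /lt_le_trans; exact.
Qed.

Lemma measurable_quantile :
  measurable_fun [set: R] (fun u => fine (equantile u)).
Proof.
by apply: measurableT_comp; [exact: fine_measurable|exact: measurable_equantile].
Qed.

(** Outside the countably many null sets of [flat_null] for rational r, no x on
    the left of X satisfies F(x) = F(X); there {x | F(x) < F(X)} is the half-line
    on the left of X, whose supremum is X. *)
Lemma quantile_dtransform :
  {ae P, forall w, fine (equantile (dtransform P X w)) = X w}.
Proof.
set F := dfun P X.
have flat (q : rat) :
    {ae P, forall w, ~ (ratr q < X w /\ F (X w) = F (ratr q))}.
  apply: (@ae_preimage _ _ _ P _ _ X
    (fun x => ~ (ratr q < x /\ F x = F (ratr q)))).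
  exists [set x | ratr q < x /\ F x = F (ratr q)]; split.
  - rewrite (_ : [set _ | _] = `]ratr q, +oo[%classic `&`
      [set x | F x = F (ratr q)]).
      by apply: measurableI => //; exact: measurable_level.
    by apply/seteqP; split => x; rewrite /= in_itv /= andbT.
  - exact: flat_null.
  - by move=> x /= /contrapT.
(* Countable intersections are indexed by nat, so the rationals are enumerated. *)
have : {ae P, forall w, forall n, if unpickle n is Some q then
    ~ (ratr q < X w /\ F (X w) = F (ratr q)) else True}.
  apply: ae_foralln => n.
  by case: (unpickle n) => [q|]; [exact: flat|exact: aeW].
apply: filterS => w flat_w.
have FX x : F x < F (X w) <-> x < X w.
  split=> [|xX].
    by apply: contraTT; rewrite -!leNgt; exact: dfun_nondecreasing.
  rewrite lt_neqAle dfun_nondecreasing ?ltW// andbT; apply/eqP => FxX.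
  have [q] := rat_in_itvoo xX; rewrite in_itv/= => /andP[xq qX].
  have := flat_w (pickle q); rewrite pickleK; apply; split => //.
  by apply/eqP; rewrite eq_le -{1}FxX !dfun_nondecreasing// ltW.
rewrite /equantile (_ : [set x | _ < _] = `]-oo, X w[%classic); last first.
  by apply/seteqP; split => x /=; rewrite in_itv/=; case: (FX x).
rewrite ereal_sup_EFin /=; first by rewrite sup_itv// bnd_simp.
  by exists (X w) => x /=; rewrite in_itv => /ltW.
by exists (X w - 1); rewrite /= in_itv/=; lra.
Qed.

Lemma distribution_itv_cy x :
  distribution P X `[x, +oo[ = (1 - dfun P X x)%:E.
Proof.
have oy : distribution P X `]x, +oo[ = (1 - dfun P X x)%:E.
  have -> : `]x, +oo[%classic = [set: R] `\` `]-oo, x]%classic.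
    by apply/seteqP; split => z /=; rewrite !in_itv/= andbT ltNge;
      [move=> /negP|move=> [_ /negP]].
  rewrite measureD//; last by rewrite (le_lt_trans (probability_le1 _ _))// ltry.
  rewrite setTI /= probability_setT EFinB /dfun /= EFinN.
  by rewrite fineK ?fin_num_measure.
rewrite -oy -(@setU1itv _ _ _ x false)// measureU//.
  by rewrite /= distribution_set1 add0e.
by apply/seteqP; split => z //= [->]; rewrite in_itv/= ltxx.
Qed.

(** For independent copies Y, Y' of X, E F(X) = P(Y' <= Y).  Integrating in the
    other order gives E(1 - F(X)), as points have no mass; hence both are 1/2. *)
Lemma mean_dtransform : \int[P]_w dtransform P X w = 2^-1.
Proof.
pose mu := distribution P X; set F := dfun P X.
have bF : bounded_measurable F.
  apply: bmf_itv01; last exact: dfun_itv01.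
  exact: measurable_dfun.
(* Tonelli for the indicator of {(x, y) | x <= y} under the law of X, twice. *)
pose S := [set z : R * R | z.1 <= z.2].
have mS : measurable S.
  rewrite (_ : S = (fun z : R * R => z.1 <= z.2) @^-1` [set true])//.
  by rewrite -[X in measurable X]setTI; exact: measurable_fun_ler.
pose f z : \bar R := (\1_S z)%:E.
have mf : measurable_fun [set: R * R] f.
  by apply/measurable_EFinP; exact: measurable_indic.
have f0 z : (0 <= f z)%E by rewrite lee_fin.
have := @fubini_tonelli _ _ _ _ _ mu mu f mf f0.
have -> : (\int[mu]_x \int[mu]_y f (x, y) = \int[mu]_x (1 - F x)%:E)%E.
  apply: eq_integral => x _; rewrite -distribution_itv_cy -/mu.
  transitivity (\int[mu]_y (\1_(`[x, +oo[%classic) y)%:E)%E; last first.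
    by rewrite integral_indic// setIT.
  apply: eq_integral => y _.
  by rewrite /f !indicE; congr ((nat_of_bool _)%:R%:E); apply/idP/idP;
    rewrite !inE /S /= in_itv/= andbT.
have -> : (\int[mu]_y \int[mu]_x f (x, y) = \int[mu]_y (F y)%:E)%E.
  apply: eq_integral => y _; rewrite dfunE.
  rewrite -[RHS]/(mu [set x | x <= y]).
  rewrite (_ : [set x | x <= y] = `]-oo, y]%classic); last first.
    by apply/seteqP; split => x; rewrite /= in_itv.
  transitivity (\int[mu]_x (\1_(`]-oo, y]%classic) x)%:E)%E; last first.
    by rewrite integral_indic// setIT.
  apply: eq_integral => x _.
  by rewrite /f !indicE; congr ((nat_of_bool _)%:R%:E); apply/idP/idP;
    rewrite !inE /S /= in_itv/=.
have meanF : \int[P]_w dtransform P X w = \int[mu]_x F x.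
  congr fine; rewrite [RHS]integral_pushforward//.
  - by apply/measurable_EFinP; case: bF.
  - exact: (bmf_integrable P measurableT (bmf_comp X bF)).
rewrite meanF => /(congr1 fine); rewrite -[LHS]/(\int[mu]_x (1 - F x)).
rewrite -[X in _ = X -> _]/(\int[mu]_x F x).
by rewrite meanB// mean_cst; lra.
Qed.

(** If F(X) were almost surely constant, its quantile X would be too, and the law
    of X would have an atom. *)
Lemma variance_dtransform : fine 'V_P[dtransform P X] != 0.
Proof.
have bV : bounded_measurable (dtransform P X).
  by apply: bmf_itv01 => // w; exact: dfun_itv01.
apply/eqP; rewrite fine_varianceE//.
move=> /(mean_sqr_eq0 P (bmfB bV (bmf_cst T _))) V0.
set m := Rintegral _ _ _ in V0; pose c := fine (equantile m).
have X0 : {ae P, forall w, X w <> c}.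
  apply: (@ae_preimage _ _ _ P _ _ X (fun x => x <> c)).
  by exists [set c]; split; [|exact: distribution_set1|move=> x /= /contrapT].
have [N [mN N0 TN]] : {ae P, forall w, False}.
  apply: filterS3 X0 V0 quantile_dtransform => w Xc /eqP.
  by rewrite subr_eq0 => /eqP -> /esym.
have : (P [set: T] <= P N)%E.
  by apply: le_measure; rewrite ?inE// => w _; exact: TN.
by rewrite N0 probability_setT lee_fin ler10.
Qed.

End continuous_marginal.

(** * Independence and conditional independence *)

Section independence.
Context d (d1 d2 : measure_display) (T : measurableType d).
Context (E1 : measurableType d1).
Context (E2 : measurableType d2) (R : realType) (P : probability T R).
Variables (Y : {RV P >-> E1}) (h : E1 -> R).
Hypothesis mh : measurable_fun [set: E1] h.
Hypothesis h01 : forall y, 0 <= h y <= 1.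

Local Notation mean f := (Rintegral P [set: T] f).

Let bh : bounded_measurable h. Proof. exact: bmf_itv01. Qed.

Lemma mean_indicator (A : set T) : measurable A -> mean (\1_A) = fine (P A).
Proof. by move=> mA; congr fine; rewrite integral_indic// setIT. Qed.

(** Independence says that 1_B(W) and the constant P(W in B) have the same
    integrals over all events {Y in A}; hence they agree against h(Y). *)
Lemma bversion_independent (W : {RV P >-> E2}) : independent_RV P Y W ->
  bounded_version P W (h \o Y) (fun=> mean (h \o Y)).
Proof.
move=> ind; split=> // B mB.
have mWB : measurable (W @^-1` B) by exact: measurable_funPTI.
pose H := \1_(W @^-1` B) : T -> R.
have bH : bounded_measurable H by exact: bmf_indic.
under eq_Rintegral do rewrite mulrC.
under [RHS]eq_Rintegral do rewrite mulrC.
rewrite meanZ// mulrC -meanZ; last exact: bmf_comp bh.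
under eq_Rintegral do rewrite mulrC.
apply/esym; apply: (mean_test (W := Y) bH (bmf_cst T (mean H)) bh) => A mA.
have mYA : measurable (Y @^-1` A) by exact: measurable_funPTI.
under [RHS]eq_Rintegral do rewrite mulrC.
rewrite meanZ; last exact: bmf_indic.
transitivity (mean (\1_(Y @^-1` A `&` W @^-1` B))).
  by rewrite indicI.
rewrite !mean_indicator//; last exact: measurableI.
by rewrite ind// fineM ?fin_num_measure// mulrC.
Qed.

Section conditional.
Context d0 (E0 : measurableType d0).
Variables (W0 : {RV P >-> E0}) (W1 : {RV P >-> E2}).
Hypothesis ci : cond_independent_RV P Y W1 W0.
Variable g0 : E0 -> R.
Hypothesis vg0 : bounded_version P W0 (h \o Y) g0.

Let bZ : bounded_measurable (h \o Y). Proof. exact: bmf_comp bh. Qed.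
Let bg0 : bounded_measurable g0. Proof. by case: vg0. Qed.
Let bg : bounded_measurable (fun w => g0 (W0 w)).
Proof. exact: bmf_comp bg0. Qed.

Lemma indic_bversion (A : set T) : measurable A ->
  exists g : E0 -> R, bounded_version P W0 (\1_A : T -> R) g /\
    {ae P, forall w, condexp P (\1_A) W0 w = g (W0 w)}.
Proof.
move=> mA; have m1 : measurable_fun [set: T] (\1_A : T -> R).
  exact: measurable_indic.
have i01 w : 0 <= (\1_A w : R) <= 1.
  by rewrite indicE; case: (w \in A); rewrite ?lexx ?ler01.
have [g [vg _]] := bversion_exists W0 m1 i01.
by exists g; split => //; exact: condexp_bversion.
Qed.

(** With k(W0) a version of P(W1 in C | W0) and Z = h(Y),
    E(1_A(W0) 1_C(W1) Z) = E(1_A(W0) k(W0) Z) = E(1_A(W0) k(W0) g0(W0))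
    = E(1_A(W0) 1_C(W1) g0(W0)).  The last two steps are the pull-out
    property for g0 and for k; the first one need only be checked for indicators of events
    {Y in D} in place of Z, where it is conditional independence.  Moving the
    projection to 1_C(W1) avoids approximating Z inside a conditional
    expectation. *)
Lemma mean_rect (A : set E0) (C : set E2) : measurable A -> measurable C ->
  mean (fun w => \1_(W0 @^-1` A `&` W1 @^-1` C) w * g0 (W0 w)) =
  mean (fun w => \1_(W0 @^-1` A `&` W1 @^-1` C) w * (h \o Y) w).
Proof.
move=> mA mC.
have mWA : measurable (W0 @^-1` A) by exact: measurable_funPTI.
have mWC : measurable (W1 @^-1` C) by exact: measurable_funPTI.
have [k [vk ck]] := indic_bversion mWC.
have [bk _] := vk.
have bA : bounded_measurable (\1_A : E0 -> R) by exact: bmf_indic.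
have bAk : bounded_measurable (fun x => \1_A x * k x) by exact: bmfM.
have bAW := bmf_comp W0 bA; have bkW := bmf_comp W0 bk.
have bAkW := bmf_comp W0 bAk.
have b1C : bounded_measurable (\1_(W1 @^-1` C) : T -> R) by exact: bmf_indic.
under eq_Rintegral do rewrite indicI/=.
under [RHS]eq_Rintegral do rewrite indicI/=.
(* Conditional independence: k(W0) replaces 1_C(W1) against functions of Y. *)
have hY : mean (fun w => h (Y w) * (\1_A (W0 w) * \1_(W1 @^-1` C) w)) =
          mean (fun w => h (Y w) * (\1_A (W0 w) * k (W0 w))).
  apply: mean_test => // [|D mD]; first exact: bmfM.
  have mYD : measurable (Y @^-1` D) by exact: measurable_funPTI.
  have [kD [vkD ckD]] := indic_bversion mYD.
  have [kDC [vkDC ckDC]] := indic_bversion (measurableI _ _ mYD mWC).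
  have [[bkD _] [bkDC _]] := (vkD, vkDC).
  have bkDW := bmf_comp W0 bkD; have bkDCW := bmf_comp W0 bkDC.
  transitivity (mean (fun w => \1_A (W0 w) * \1_(Y @^-1` D `&` W1 @^-1` C) w)).
    by apply: eq_Rintegral => w _; rewrite indicI /=; ring.
  rewrite -(bversion_test _ vkDC bA)//; last exact/bmf_indic/measurableI.
  transitivity (mean (fun w => (\1_A (W0 w) * k (W0 w)) * kD (W0 w))).
    apply: mean_ae.
    - by case: (bmfM bAW bkDCW).
    - by case: (bmfM bAkW bkDW).
    - have cc : {ae P, forall w, kDC (W0 w) =
          condexp P (\1_(Y @^-1` D)) W0 w * condexp P (\1_(W1 @^-1` C)) W0 w}.
        by apply: filterS2 ckDC (ci mD mC) => w /= <- ->.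
      apply: filterS3 ck ckD cc => w /= <- <- ->.
      by rewrite mulrAC mulrA.
  rewrite (bversion_test _ vkD bAk)//; last exact: bmf_indic.
  by apply: eq_Rintegral => w _; ring.
transitivity (mean (fun w => \1_A (W0 w) * g0 (W0 w) * \1_(W1 @^-1` C) w)).
  by apply: eq_Rintegral => w _; rewrite /=; ring.
have bAg : bounded_measurable (fun x => \1_A x * g0 x) by exact: bmfM.
rewrite -(bversion_test b1C vk bAg).
transitivity (mean (fun w => (\1_A (W0 w) * k (W0 w)) * g0 (W0 w))).
  by apply: eq_Rintegral => w _; rewrite /=; ring.
rewrite (bversion_test bZ vg0 bAk).
transitivity (mean (fun w => h (Y w) * (\1_A (W0 w) * k (W0 w)))).
  by apply: eq_Rintegral => w _; rewrite /=; ring.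
by rewrite -hY; apply: eq_Rintegral => w _; rewrite /=; ring.
Qed.

(** Both sides are signed measures of S that agree on rectangles, a generating
    class stable under intersection. *)
Lemma mean_pair (S : set (E0 * E2)) : measurable S ->
  mean (fun w => \1_[set w | S (W0 w, W1 w)] w * g0 (W0 w)) =
  mean (fun w => \1_[set w | S (W0 w, W1 w)] w * (h \o Y) w).
Proof.
pose pre (S : set (E0 * E2)) := [set w | S (W0 w, W1 w)].
pose D w := g0 (W0 w) - h (Y w).
have bD : bounded_measurable D by exact: bmfB.
have mpre S' : measurable S' -> measurable (pre S').
  have mW : measurable_fun [set: T] (fun w => (W0 w, W1 w)).
    exact: measurable_fun_pair.
  by move=> mS'; rewrite -[X in measurable X]setTI; exact: mW.
have eqD (A : set T) : measurable A ->
    mean (fun w => \1_A w * g0 (W0 w)) = mean (fun w => \1_A w * (h \o Y) w) <->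
    (\int[P]_(w in A) (D w)%:E = 0)%E.
  move=> mA; rewrite -(fineK (integrable_fin_num mA (bmf_integrable P mA bD))).
  have -> : fine (\int[P]_(w in A) (EFin \o D) w) =
      mean (fun w => \1_A w * g0 (W0 w)) - mean (fun w => \1_A w * (h \o Y) w).
    rewrite -[LHS]/(\int[P]_(w in A) D w) -mean_indicM -meanB.
    + by apply: eq_Rintegral => w _; rewrite mulrBr.
    + by apply: bmfM => //; exact: bmf_indic.
    + by apply: bmfM => //; exact: bmf_indic.
  split => [->|[] /eqP]; first by rewrite subrr.
  by rewrite subr_eq0 => /eqP.
pose G := [set A `*` B | A in @measurable _ E0 & B in @measurable _ E2].
pose H S' := measurable S' /\ (\int[P]_(w in pre S') (D w)%:E = 0)%E.
have iD A : measurable A -> P.-integrable A (EFin \o D).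
  by move=> mA; exact: bmf_integrable.
have rect A B : measurable A -> measurable B -> H (A `*` B).
  move=> mA mB; split; first exact: measurableX.
  apply/eqD; first by apply: mpre; exact: measurableX.
  exact: mean_rect mA mB.
have dH : lambda_system [set: E0 * E2] H.
  apply/dynkin_lambda_system; split.
  - by rewrite -setXTT; exact: rect.
  - move=> A [mA A0]; split; first exact: measurableC.
    have [_ T0] := rect _ _ (@measurableT _ E0) (@measurableT _ E2).
    rewrite setXTT in T0; move: T0.
    rewrite -{1}(setUv A) -[pre _]/(pre A `|` pre (~` A)).
    rewrite integral_setU//.
    + by rewrite A0 add0e.
    + exact: mpre.
    + by apply: mpre; exact: measurableC.
    + by apply/measurable_EFinP; apply: measurable_funTS; case: bD.
    + by apply/disj_setPS => w [].
  - move=> F tF HF; split.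
      by apply: bigcup_measurable => n _; case: (HF n).
    rewrite -[pre _]/(\bigcup_n pre (F n)) integral_bigcup//.
    + by apply: eseries0 => n _ _; case: (HF n).
    + by move=> i k _ _ [w [Fi Fk]]; apply: (tF i k) => //; exists (W0 w, W1 w).
    + by move=> n; apply: mpre; case: (HF n).
    + by apply: iD; apply: bigcup_measurable => n _; apply: mpre; case: (HF n).
move=> mS; apply/eqD; first exact: mpre.
suff : H S by case.
have GH : G `<=` H by move=> _ [A mA [B mB <-]]; exact: rect.
rewrite measurable_prod_measurableType in mS.
apply: (lambda_system_subset _ dH GH) mS => //.
move=> _ _ [A mA [B mB <-]] [A' mA' [B' mB' <-]]; rewrite -setXI.
exists (A `&` A'); first exact: measurableI.
by exists (B `&` B') => //; exact: measurableI.
Qed.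

(** E(Z | W0), seen as a function of W, is a version of E(Z | W). *)
Lemma R2_cond_independent d3 (E : measurableType d3) (W : {RV P >-> E})
    (p0 : E -> E0) (glue : E0 * E2 -> E) :
  measurable_fun [set: E] p0 -> measurable_fun [set: E0 * E2] glue ->
  (forall w, W0 w = p0 (W w)) -> (forall w, W w = glue (W0 w, W1 w)) ->
  R2 P (h \o Y) W = R2 P (h \o Y) W0.
Proof.
move=> mp0 mglue W0E WE.
have Z01 w : 0 <= (h \o Y) w <= 1 by exact: h01.
have mZ : measurable_fun [set: T] (h \o Y) by case: bZ.
have vW : bounded_version P W (h \o Y) (g0 \o p0).
  split.
    have [mg0 [M gM]] := bg0; split; last by exists M => x; exact: gM.
    exact: measurableT_comp.
  move=> B mB; under eq_Rintegral do rewrite /= -W0E.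
  have mS : measurable (glue @^-1` B).
    by rewrite -[X in measurable X]setTI; exact: mglue.
  have := mean_pair mS; rewrite (_ : [set w | _] = W @^-1` B)//.
  by apply/seteqP; split => w /=; rewrite WE.
rewrite (R2_bversion mZ Z01 vW) (R2_bversion mZ Z01 vg0).
by under eq_Rintegral do rewrite /= -W0E.
Qed.

End conditional.
End independence.

(** * Random vectors *)

Section vectors.
Context d (T : measurableType d) (R : realType) (P : probability T R).

Lemma measurable_mktuple d' (E : measurableType d') n (q : 'I_n -> E -> R) :
  (forall i, measurable_fun [set: E] (q i)) ->
  measurable_fun [set: E] (fun x => [tuple q i x | i < n]).
Proof.
move=> mq; apply/measurable_fun_tnthP => i.
by rewrite (_ : _ \o _ = q i)//; apply/funext => x /=; rewrite tnth_mktuple.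
Qed.

Lemma tnth_rvec n (X : 'I_n -> {RV P >-> R}) w i : tnth (rvec X w) i = X i w.
Proof. by rewrite tnth_mktuple. Qed.

Definition uniformized n (X : 'I_n -> {RV P >-> R}) : 'I_n -> {RV P >-> R} :=
  fun i => dtransform P (X i).

(** The marginal transforms lose no information: the quantile functions undo them
    almost surely. *)
Lemma R2_uniformized (Z : T -> R) n (X : 'I_n -> {RV P >-> R}) :
  measurable_fun [set: T] Z -> (forall w, 0 <= Z w <= 1) ->
  (forall i, continuous (dfun P (X i))) ->
  R2 P Z (rvec (uniformized X)) = R2 P Z (rvec X).
Proof.
move=> mZ Z01 cF.
apply: (R2_eq mZ Z01 (phi := fun t => [tuple dfun P (X i) (tnth t i) | i < n])
  (psi := fun t => [tuple fine (equantile (X i) (tnth t i)) | i < n])).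
- apply: measurable_mktuple => i.
  exact: (measurableT_comp (measurable_dfun (X i)) (measurable_tnth i)).
- by apply: aeW => w; apply: eq_mktuple => i; rewrite tnth_rvec.
- apply: measurable_mktuple => i.
  exact: (measurableT_comp (measurable_quantile (X i)) (measurable_tnth i)).
- have : {ae P, forall w, forall i,
      fine (equantile (X i) (dtransform P (X i) w)) = X i w}.
    by apply: filter_forall => i; exact: quantile_dtransform.
  apply: filterS => w Xw; apply: eq_mktuple => i.
  by rewrite tnth_rvec Xw.
Qed.

Lemma dfun_increasing (X X' : {RV P >-> R}) (h : R -> R) :
  (forall x y, x < y -> h x < h y) -> (forall w, X' w = h (X w)) ->
  forall x, dfun P X' (h x) = dfun P X x.
Proof.
move=> h_incr X'E x; apply: EFin_inj; rewrite !dfunE; congr (P _).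
apply/seteqP; split => w /=; rewrite X'E.
  by apply: contraTT; rewrite -!ltNge; exact: h_incr.
by rewrite le_eqVlt => /predU1P[->//|/h_incr/ltW].
Qed.

(** A decreasing h turns {X' <= h(x)} into {X >= x}, whose mass is 1 - F(x)
    because F has no jump at x. *)
Lemma dfun_decreasing (X X' : {RV P >-> R}) (h : R -> R) :
  continuous (dfun P X) ->
  (forall x y, x < y -> h y < h x) -> (forall w, X' w = h (X w)) ->
  forall x, dfun P X' (h x) = 1 - dfun P X x.
Proof.
move=> cF h_decr X'E x; apply: EFin_inj.
rewrite -distribution_itv_cy// dfunE; congr (P _).
apply/seteqP; split => w /=; rewrite X'E in_itv/= andbT.
  by apply: contraTT; rewrite -!ltNge; exact: h_decr.
by rewrite le_eqVlt => /predU1P[->//|/h_decr/ltW].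
Qed.

Lemma R2_permutation (Z : T -> R) n (X : 'I_n -> {RV P >-> R})
    (s : {perm 'I_n}) :
  measurable_fun [set: T] Z -> (forall w, 0 <= Z w <= 1) ->
  R2 P Z (rvec (fun i => X (s i))) = R2 P Z (rvec X).
Proof.
move=> mZ Z01.
apply: (R2_eq mZ Z01 (phi := fun t => [tuple tnth t (s i) | i < n])
  (psi := fun t => [tuple tnth t (s^-1%g i) | i < n])).
- by apply: measurable_mktuple => i; exact: measurable_tnth.
- by apply: aeW => w; apply: eq_mktuple => i; rewrite tnth_rvec.
- by apply: measurable_mktuple => i; exact: measurable_tnth.
- by apply: aeW => w; apply: eq_mktuple => i; rewrite tnth_rvec permKV.
Qed.

(** Each coordinate of the transformed vector is F_i(X_i) or 1 - F_i(X_i),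
    according to the direction of h_i, and the flip u |-> 1 - u is an involution. *)
Lemma R2_monotone_transform (Z : T -> R) n (X X' : 'I_n -> {RV P >-> R})
    (h : 'I_n -> R -> R) :
  measurable_fun [set: T] Z -> (forall w, 0 <= Z w <= 1) ->
  (forall i, continuous (dfun P (X i))) ->
  (forall i, (forall x y, x < y -> h i x < h i y) \/
             (forall x y, x < y -> h i y < h i x)) ->
  (forall i w, X' i w = h i (X i w)) ->
  R2 P Z (rvec (uniformized X')) = R2 P Z (rvec (uniformized X)).
Proof.
move=> mZ Z01 cF hmono X'E.
(* b records the coordinates that do not change, among them all those with an
   increasing h_i. *)
pose b i := `[< forall w, dtransform P (X' i) w = dtransform P (X i) w >].
pose flip i (u : R) := if b i then u else 1 - u.
have flipE i w : dtransform P (X' i) w = flip i (dtransform P (X i) w).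
  rewrite /flip /b; case: asboolP => [->//|ne].
  rewrite /dtransform /= X'E; case: (hmono i) => hi; last first.
    exact: dfun_decreasing.
  exfalso; apply: ne => w'.
  by rewrite /dtransform /= X'E; exact: dfun_increasing.
have flipK i u : flip i (flip i u) = u.
  by rewrite /flip; case: (b i); rewrite ?subKr.
have mflip : measurable_fun [set: n.-tuple R]
    (fun t => [tuple flip i (tnth t i) | i < n]).
  apply: measurable_mktuple => i; rewrite /flip; case: (b i).
    exact: measurable_tnth.
  by apply: measurable_funB => //; exact: measurable_tnth.
apply: (R2_eq mZ Z01 mflip _ mflip); apply: aeW => w; apply: eq_mktuple => i.
  by rewrite tnth_rvec; exact: flipE.
by rewrite tnth_rvec -[RHS]/(flip i (dtransform P (X' i) w)) flipE flipK.
Qed.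

Lemma R2_initial (Z : T -> R) n k (hk : (k < n)%N) (X : 'I_n -> {RV P >-> R}) :
  measurable_fun [set: T] Z -> (forall w, 0 <= Z w <= 1) ->
  R2 P Z (rvec (initial (ltnW hk) X)) <= R2 P Z (rvec (initial hk X)).
Proof.
move=> mZ Z01.
apply: (R2_le mZ Z01
  (phi := fun t => [tuple tnth t (widen_ord (leqnSn k) i) | i < k])).
  by apply: measurable_mktuple => i; exact: measurable_tnth.
apply: aeW => w; apply: eq_mktuple => i; rewrite tnth_rvec /initial.
by congr (X _ w); exact: val_inj.
Qed.

Lemma R2_initial_cond_independent (Y : {RV P >-> R}) (h : R -> R) n k
    (hk : (k <= n)%N) (X : 'I_n -> {RV P >-> R}) :
  measurable_fun [set: R] h -> (forall y, 0 <= h y <= 1) ->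
  cond_independent_RV P Y (rvec (final hk X)) (rvec (initial hk X)) ->
  R2 P (h \o Y) (rvec X) = R2 P (h \o Y) (rvec (initial hk X)).
Proof.
move=> mh h01 ci.
have mZ : measurable_fun [set: T] (h \o Y) by exact: measurableT_comp.
have Z01 w : 0 <= (h \o Y) w <= 1 by exact: h01.
have [g0 [vg0 _]] := bversion_exists (P := P) (rvec (initial hk X)) mZ Z01.
pose glue (z : k.-tuple R * (n - k).-tuple R) : n.-tuple R :=
  [tuple match fintype.split (cast_ord (esym (subnKC hk)) i) with
         | inl j => tnth z.1 j | inr j => tnth z.2 j end | i < n].
pose p0 (t : n.-tuple R) := [tuple tnth t (widen_ord hk i) | i < k].
apply: (R2_cond_independent mh h01 ci vg0 (p0 := p0) (glue := glue)).
- by apply: measurable_mktuple => i; exact: measurable_tnth.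
- apply: measurable_mktuple => i; case: (fintype.split _) => j.
    exact: (measurableT_comp (measurable_tnth j) measurable_fst).
  exact: (measurableT_comp (measurable_tnth j) measurable_snd).
- by move=> w; apply: eq_mktuple => i; rewrite tnth_rvec.
- move=> w; apply: eq_mktuple => i.
  case: splitP => j ij; rewrite tnth_rvec; congr (X _ w); exact: val_inj.
Qed.

End vectors.

(** * Properties of the coefficient of determination *)

Theorem corollary6 (disp : measure_display) (T : measurableType disp)
    (R : realType) (P : probability T R) (d : nat) (hd : (1 <= d)%N)
    (X : 'I_d -> {RV P >-> R}) (Y : {RV P >-> R})
    (hF : forall i, continuous (dfun P (X i))) (hG : continuous (dfun P Y)) :
  let U (X' : 'I_d -> {RV P >-> R}) : 'I_d -> {RV P >-> R} :=
    fun i => dtransform P (X' i) in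
  let V : {RV P >-> R} := dtransform P Y in
  [/\ (* (i) *)
      R2 P V (rvec (U X)) = 1 <-> completely_dependent P Y (rvec X),
      (* (ii) *)
      (R2 P V (rvec (U X)) = 0 <->
         {ae distribution P (rvec (U X)), forall u : d.-tuple R,
            (forall i, 0 <= tnth u i <= 1) ->
            condexp_at P V (rvec (U X)) u = 2^-1}) /\
      (independent_RV P Y (rvec X) -> R2 P V (rvec (U X)) = 0),
      (* (iii) *)
      forall s : {perm 'I_d},
        R2 P V (rvec (U (fun i => X (s i)))) = R2 P V (rvec (U X)),
      (* (iv) *)
      forall (h : 'I_d -> R -> R) (X' : 'I_d -> {RV P >-> R}),
        (forall i, continuous (h i)) ->
        (forall i, (forall x y, x < y -> h i x < h i y) \/
                   (forall x y, x < y -> h i y < h i x)) ->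
        (forall i w, X' i w = h i (X i w)) ->
        R2 P V (rvec (U X')) = R2 P V (rvec (U X)) &
      (* (v) *)
      (forall (k : nat) (hk : (k < d)%N), (1 <= k)%N ->
         R2 P V (rvec (initial (ltnW hk) (U X))) <=
         R2 P V (rvec (initial hk (U X)))) /\
      (forall (k : nat) (hk : (k < d)%N), (1 <= k)%N ->
         cond_independent_RV P Y (rvec (final (ltnW hk) X))
           (rvec (initial (ltnW hk) X)) ->
         R2 P V (rvec (U X)) = R2 P V (rvec (initial (ltnW hk) (U X))))].

Proof.
move=> U V.
have mV : measurable_fun [set: T] V by exact: measurable_funPT.
have V01 w : 0 <= V w <= 1 by exact: dfun_itv01.
have bV : bounded_measurable V by exact: bmf_itv01.
have meanV : \int[P]_w V w = 2^-1 by exact: mean_dtransform.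
have V0 : fine 'V_P[V] != 0 by exact: variance_dtransform.
have mG : measurable_fun [set: R] (dfun P Y).
  exact: measurable_dfun.
have UX n (X' : 'I_n -> {RV P >-> R}) :
    (forall i, continuous (dfun P (X' i))) ->
    R2 P V (rvec (uniformized X')) = R2 P V (rvec X').
  exact: R2_uniformized.
split.
- rewrite (UX _ X hF) (R2_eq1 mV V01 _ V0); split=> -[f mf].
  + have mf' : measurable_fun [set: d.-tuple R]
        (fun u => fine (equantile Y (f u))).
      exact: (measurableT_comp (measurable_quantile Y) mf).
    move=> Vf; exists (fun u => fine (equantile Y (f u))) => //.
    apply/ae_probability1.
      apply: measurable_eq_set => //.
      exact: (measurableT_comp mf' (measurable_funPT (rvec X))).
    by apply: filterS2 Vf (quantile_dtransform hG) => w /= <- ->.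
  + have mY : measurable [set w | Y w = f (rvec X w)].
      apply: measurable_eq_set => //.
      exact: (measurableT_comp mf (measurable_funPT (rvec X))).
    move=> /(ae_probability1 P mY) Yf; exists (dfun P Y \o f).
      exact: measurableT_comp.
    by apply: filterS Yf => w /= <-.
- split; last first.
    move=> ind; rewrite (UX _ X hF).
    rewrite (R2_bversion mV V01 (bversion_independent mG (dfun_itv01 Y) ind)).
    by rewrite mean_cst subrr mul0r.
  rewrite (R2_eq0 mV V01 _ V0) meanV; split => cV.
  + have : {ae distribution P (rvec (U X)), forall u,
        condexp_at P V (rvec (U X)) u = 2^-1}.
      apply: (ae_distribution _ cV); apply: measurable_eq_set => //.
      by case: (condexp_atP (rvec (U X)) (bmf_integrable P measurableT bV)).
    by apply: filterS => u ->.
  + have := ae_preimage cV; apply: filterS => w; apply => i.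
    rewrite tnth_rvec; exact: dfun_itv01.
- by move=> s; exact: (R2_permutation (U X)).
- move=> h X' _ hmono X'E; exact: (R2_monotone_transform mV V01 hF hmono X'E).
- split => k hk _; first exact: R2_initial.
  move=> ci; rewrite (UX _ X hF).
  rewrite -[rvec (initial _ (U X))]/(rvec (uniformized (initial (ltnW hk) X))).
  rewrite UX => [|i]; last exact: hF.
  exact: (R2_initial_cond_independent mG (dfun_itv01 Y) ci).
Qed.
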